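(* Let the existence, consistency and well-configuredness assumptions below hold. Suppose $f(x)=\sum_{i=1}^m f_i(x_i)$ is strictly convex on $\mathbb{R}^{mn}$ and each $f_i$ is convex for all $i\in\mathcal{V}$. Then for any given $x(0)$, the distributed update $$\dot{x}_i(t) = -\nabla f_i(x_i(t)) - \sum_{j\in\mathcal{N}_i} P_{ij}(\lambda_i(t)-\lambda_j(t)) - \sum_{j\in\mathcal{N}_i} P_{ij}(x_i(t)-x_j(t)-\bar b_{ij}),\qquad \dot{\lambda}_i(t) = \sum_{j\in\mathcal{N}_i} P_{ij}(x_i(t)-x_j(t)-\bar b_{ij}),$$ with $P_{ij} = A_{ij}'(A_{ij}A_{ij}')^{-1}A_{ij}$ and $\bar b_{ij} = A_{ij}'(A_{ij}A_{ij}')^{-1}b_{ij}$, drives each $x_i(t)$ to converge asymptotically to a constant $x_i^*$, $i\in\mathcal{V}$, such that $(x_1^*,\dots,x_m^* )$ solves $$\min_{x_1,\dots,x_m}\ \sum_{i=1}^m f_i(x_i)\quad \text{s.t.}\quad A_{ij}(x_i-x_j)=b_{ij},\ \forall (i,j)\in\mathcal{E}.$$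
   Context: A multi-agent system of $m$ agents $\mathcal{V}=\{1,\dots,m\}$; agent $i$ is a single integrator with state $x_i\in\mathbb{R}^n$ and communicates bidirectionally with neighbors $\mathcal{N}_i$ ($i\notin\mathcal{N}_i$); $\mathbb{G}=\{\mathcal{V},\mathcal{E}\}$ is the undirected graph with $\bar m=|\mathcal{E}|$ edges. Each $f_i:\mathbb{R}^n\to\mathbb{R}$ is continuously differentiable and convex, known only to agent $i$. $A_{ij}\in\mathbb{R}^{d_{ij}\times n}$, $b_{ij}\in\mathbb{R}^{d_{ij}}$ are constant, known to agent $i$ (with $A_{ij}A_{ij}'$ invertible). $x=\mathrm{col}\{x_1,\dots,x_m\}$, $\lambda=\mathrm{col}\{\lambda_1,\dots,\lambda_m\}\in\mathbb{R}^{mn}$ are Lagrange multipliers. Let $H\in\mathbb{R}^{\bar m\times m}$ be the oriented incidence matrix of $\mathbb{G}$ (orientations consistent with the $b_{ij}$), $\bar H = H\otimes I_n$, $\bar P=\mathrm{diag}\{P_{i_1j_1},\dots,P_{i_{\bar m}j_{\bar m}}\}$, $\bar b = \mathrm{col}\{\bar b_{i_1j_1},\dots,\bar b_{i_{\bar m}j_{\bar m}}\}$ where $(i_l,j_l)$ is the $l$-th edge. Assumptions: (Existence) the optimization problem has at least one solution satisfying the edge agreements; (Consistency) $A_{ij}=A_{ji}$, $b_{ij}=-b_{ji}$ for all $(i,j)\in\mathcal{E}$; (Well-configured) $\mathbb{G}$ is connected and $\ker \bar H' \cap \mathrm{image}\,\bar P = \{0\}$. The update is the saddle-point (gradient descent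 in $x$, ascent in $\lambda$) dynamics of the augmented Lagrangian $F(x,\lambda)=f(x)+\lambda'\bar H'\bar P(\bar Hx-\bar b)+\tfrac12\|\bar P(\bar Hx-\bar b)\|^2$. *)

(* Defs.v *)
From HB Require Import structures.
From mathcomp Require Import all_boot all_order all_algebra.
From mathcomp Require Import all_classical all_reals all_analysis.
Set Implicit Arguments. Unset Strict Implicit. Unset Printing Implicit Defensive.
Import Order.TTheory GRing.Theory Num.Theory.
Import numFieldNormedType.Exports.
Local Open Scope ring_scope.

Section Defs.
Variable R : realType.

Definition dotp (n : nat) (u v : 'cV[R]_n) : R := (u^T *m v) 0 0.

Definition is_gradient (n : nat) (h : 'cV[R]_n -> R) (g : 'cV[R]_n -> 'cV[R]_n) :=
  forall x v : 'cV[R]_n, is_derive x v h (dotp (g x) v).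

Definition convex_fun (n : nat) (h : 'cV[R]_n -> R) :=
  forall (x y : 'cV[R]_n) (t : R), 0 <= t <= 1 ->
    h (t *: x + (1 - t) *: y) <= t * h x + (1 - t) * h y.

Definition sumf (m n : nat) (f : 'I_m -> 'cV[R]_n -> R) (X : 'I_m -> 'cV[R]_n) : R :=
  \sum_(i < m) f i (X i).

Definition strictly_convex_stack (m n : nat) (F : ('I_m -> 'cV[R]_n) -> R) :=
  forall (X Y : 'I_m -> 'cV[R]_n) (t : R), X <> Y -> 0 < t < 1 ->
    F (fun i => t *: X i + (1 - t) *: Y i) < t * F X + (1 - t) * F Y.

Definition Pmat (d n : nat) (A : 'M[R]_(d, n)) : 'M[R]_n :=
  A^T *m invmx (A *m A^T) *m A.

Definition bbar (d n : nat) (A : 'M[R]_(d, n)) (b : 'cV[R]_d) : 'cV[R]_n :=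
  A^T *m invmx (A *m A^T) *m b.

Definition feasible (m n : nat) (adj : rel 'I_m) (d : 'I_m -> 'I_m -> nat)
  (A : forall i j, 'M[R]_(d i j, n)) (b : forall i j, 'cV[R]_(d i j))
  (X : 'I_m -> 'cV[R]_n) : Prop :=
  forall i j, adj i j -> A i j *m (X i - X j) = b i j.

Definition is_solution (m n : nat) (f : 'I_m -> 'cV[R]_n -> R) (adj : rel 'I_m)
  (d : 'I_m -> 'I_m -> nat)
  (A : forall i j, 'M[R]_(d i j, n)) (b : forall i j, 'cV[R]_(d i j))
  (X : 'I_m -> 'cV[R]_n) : Prop :=
  feasible adj A b X /\
  forall Y, feasible adj A b Y -> sumf f X <= sumf f Y.

(* ker Hbar' /\ image Pbar = {0}.  Edges are oriented as (i,j) with i < j;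
   a vector of R^{mbar n} is z = (z_e)_e with z_e = z i j for e = (i,j).
   z \in image Pbar  <=>  each z_e = P_e w_e;  Hbar' z = 0  <=>  for every node k,
   \sum_e H_{e k} z_e = 0 with H_{e k} = 1 if k is the tail, -1 if k is the head. *)
Definition well_configured_kernel (m n : nat) (adj : rel 'I_m)
  (P : 'I_m -> 'I_m -> 'M[R]_n) : Prop :=
  forall z : 'I_m -> 'I_m -> 'cV[R]_n,
    (forall i j, adj i j -> (i < j)%N -> exists w, z i j = P i j *m w) ->
    (forall k : 'I_m,
       \sum_(i < m) \sum_(j < m | adj i j && (i < j)%N)
          (((i == k)%:R - (j == k)%:R) : R) *: z i j = 0) ->
    forall i j, adj i j -> (i < j)%N -> z i j = 0.

End Defs.

(* Main.v *)
(* With edge projections [P_ij] and Laplacian [L v i = sum_j P_ij (v_i - v_j)],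
   feasibility of the optimum [xs] turns the dynamics into
     x' = - grad f(x) - L lam - L (x - xs),   lam' = L (x - xs).
   At [xs] the gradient is orthogonal to [ker L], so [L] being self-adjoint there
   is a multiplier [ls] with [grad f(xs) + L ls = 0].  The cross terms cancel in
   the derivative of V = |x - xs|^2 + |lam - ls|^2, which leaves
     V' <= - 2 sum_i (x_i - xs_i) . (grad f_i(x_i) - grad f_i(xs_i)).
   Strict convexity of the sum makes each [f_i] strictly convex, so each summand is
   positive for [x_i <> xs_i], and bounded below on every compact annulus around
   [xs_i].  All trajectories are bounded, hence [|x_i - xs_i|^2] has a bounded
   derivative, and a Barbalat argument gives [x_i --> xs_i]. *)
Require Import Defs.
From HB Require Import structures.
From mathcomp Require Import all_boot all_order all_algebra.
From mathcomp Require Import all_classical all_reals all_analysis.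
From mathcomp Require Import lra.
Set Implicit Arguments. Unset Strict Implicit. Unset Printing Implicit Defensive.
Import Order.TTheory GRing.Theory Num.Theory.
Import numFieldNormedType.Exports.
Local Open Scope ring_scope.
Local Open Scope classical_set_scope.

(** * Algebra of the Euclidean inner product on columns *)

Section DotProduct.
Context {R : realType} {n : nat}.
Implicit Types (u v w : 'cV[R]_n) (a : R).

Lemma dotpE u v : dotp u v = \sum_k u k 0 * v k 0.
Proof. by rewrite /dotp mxE; apply: eq_bigr => k _; rewrite mxE. Qed.

Lemma dotpC u v : dotp u v = dotp v u.
Proof. by rewrite !dotpE; apply: eq_bigr => k _; rewrite mulrC. Qed.

Lemma dotpDr u v w : dotp u (v + w) = dotp u v + dotp u w.
Proof. by rewrite /dotp mulmxDr mxE. Qed.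

Lemma dotpDl u v w : dotp (u + v) w = dotp u w + dotp v w.
Proof. by rewrite !(dotpC _ w) dotpDr. Qed.

Lemma dotpZr a u v : dotp u (a *: v) = a * dotp u v.
Proof. by rewrite /dotp -scalemxAr mxE. Qed.

Lemma dotpNr u v : dotp u (- v) = - dotp u v.
Proof. by rewrite -scaleN1r dotpZr mulN1r. Qed.

Lemma dotpNl u v : dotp (- u) v = - dotp u v.
Proof. by rewrite !(dotpC _ v) dotpNr. Qed.

Lemma dotp0r u : dotp u 0 = 0.
Proof. by rewrite -(scale0r 0) dotpZr mul0r. Qed.

Lemma dotpBr u v w : dotp u (v - w) = dotp u v - dotp u w.
Proof. by rewrite dotpDr dotpNr. Qed.

Lemma dotpBl u v w : dotp (u - v) w = dotp u w - dotp v w.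
Proof. by rewrite dotpDl dotpNl. Qed.

Lemma dotp_sumr (I : finType) (P : pred I) u (F : I -> 'cV[R]_n) :
  dotp u (\sum_(i | P i) F i) = \sum_(i | P i) dotp u (F i).
Proof. by rewrite /dotp mulmx_sumr summxE. Qed.

Lemma dotp_trmx_mull (B : 'M[R]_n) u v : dotp (B^T *m u) v = dotp u (B *m v).
Proof. by rewrite /dotp trmx_mul trmxK mulmxA. Qed.

Lemma dotp_ge0 u : 0 <= dotp u u.
Proof. by rewrite dotpE; apply: sumr_ge0 => k _; rewrite -expr2 sqr_ge0. Qed.

Lemma dotp_projection (B : 'M[R]_n) u : B^T = B -> B *m B = B ->
  dotp u (B *m u) = dotp (B *m u) (B *m u).
Proof. by move=> BT BB; rewrite -[in RHS]dotp_trmx_mull BT mulmxA BB dotpC. Qed.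

Lemma sqr_coord_le_dotp u k : u k 0 ^+ 2 <= dotp u u.
Proof.
rewrite dotpE (bigD1 k)//= -expr2 lerDl.
by apply: sumr_ge0 => j _; rewrite -expr2 sqr_ge0.
Qed.

Lemma dotp_eq0 u : dotp u u = 0 -> u = 0.
Proof.
move=> u0; apply/colP => k; rewrite mxE; apply/eqP.
by rewrite -sqrf_eq0 eq_le sqr_ge0 andbT -u0 sqr_coord_le_dotp.
Qed.

End DotProduct.

(** * Product rule for inner products of curves *)

Section DerivativeOfDotProduct.
Context {R : realType} {n : nat}.

Lemma is_derive_coord (u : R -> 'cV[R]_n) (t : R) du (k : 'I_n) :
  is_derive t 1 u du -> is_derive t 1 (fun s => u s k 0) (du k 0).
Proof.
move=> [udrv <-]; apply: DeriveDef; first exact: (derivable_mxP _ _ _).1.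
by rewrite derive_mx// mxE.
Qed.

Lemma is_derive_dotp (u v : R -> 'cV[R]_n) (t : R) du dv :
  is_derive t 1 u du -> is_derive t 1 v dv ->
  is_derive t 1 (fun s => dotp (u s) (v s)) (dotp du (v t) + dotp (u t) dv).
Proof.
move=> hu hv.
have -> : (fun s => dotp (u s) (v s)) =
    \sum_(k < n) ((fun s => u s k 0) * (fun s => v s k 0)).
  by apply/funext => s; rewrite dotpE fct_sumE.
have huv k : is_derive t 1 ((fun s => u s k 0) * (fun s => v s k 0))
    (u t k 0 *: dv k 0 + v t k 0 *: du k 0).
  by apply: is_deriveM; exact: is_derive_coord.
apply: is_derive_eq (is_derive_sum huv) _.
rewrite !dotpE -big_split; apply: eq_bigr => k _ /=.
by rewrite /GRing.scale/= addrC (mulrC (v t k 0)).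
Qed.

End DerivativeOfDotProduct.

(** * Directional derivatives as one-variable derivatives *)

Section DirectionalDerivative.
Context {R : realType} {n : nat}.
Implicit Types (h : 'cV[R]_n -> R) (x v : 'cV[R]_n).

Lemma is_derive_line h x v D :
  is_derive x v h D -> is_derive (0 : R) 1 (fun s : R => h (x + s *: v)) D.
Proof.
move=> [/= hd <-].
have e : (fun s : R => s^-1 *: (((fun s : R => h (x + s *: v)) \o shift 0)
     (s *: 1) - h (x + 0 *: v))) =
   (fun s : R => s^-1 *: ((h \o shift x) (s *: v) - h x)).
  apply/funext => s /=.
  by rewrite /shift/= addr0 scale0r addr0 [s *: 1]mulr1 [x + _]addrC.
by apply: DeriveDef; rewrite /derivable /derive e.
Qed.

(** The derivative is also the limit of right difference quotients, so bounds on [0 < s < 1], the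
    range that convex combinations supply, suffice. *)
Lemma is_derive_le (g : R -> R) (D c : R) : is_derive (0 : R) 1 g D ->
  (forall s, 0 < s < 1 -> g s - g 0 <= s * c) -> D <= c.
Proof.
move=> [gd <-] gc.
apply: (cvgr_to_le (cvg_dnbhs_at_right gd)).
near=> s.
have s0 : 0 < s by near: s; exact: nbhs_right_gt.
have s1 : s < 1 by near: s; exact: nbhs_right_lt.
rewrite /shift/= addr0 [s *: 1]mulr1 /GRing.scale/= ler_pdivrMl//.
by apply: gc; rewrite s0.
Unshelve. all: by end_near. Qed.

End DirectionalDerivative.

(** * First-order inequalities for convex functions *)

Section ConvexGradient.
Context {R : realType} {n : nat}.
Context (h : 'cV[R]_n -> R) (g : 'cV[R]_n -> 'cV[R]_n).
Hypothesis hg : is_gradient h g.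

Lemma convex_gradient_le : convex_fun h ->
  forall x y : 'cV[R]_n, dotp (g x) (y - x) <= h y - h x.
Proof.
move=> hc x y; apply: (is_derive_le (is_derive_line (hg x (y - x)))) => s s01.
have -> : x + s *: (y - x) = s *: y + (1 - s) *: x.
  by rewrite scalerBr scalerBl scale1r addrC -addrA (addrC _ x).
have s01' : 0 <= s <= 1 by move/andP: s01 => [/ltW-> /ltW->].
have := hc y x s s01'; rewrite scale0r addr0; lra.
Qed.

(** Passing to the limit would lose strictness. Instead the weak inequality is applied at the
    midpoint of [x] and [y], where strict convexity bounds [h] strictly below the chord. *)
Lemma strictly_convex_gradient_lt :
  (forall (x y : 'cV[R]_n) (t : R), x <> y -> 0 < t < 1 ->
    h (t *: x + (1 - t) *: y) < t * h x + (1 - t) * h y) ->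
  convex_fun h ->
  forall x y : 'cV[R]_n, x <> y -> dotp (g x) (y - x) < h y - h x.
Proof.
move=> hsc hc x y xy.
have := convex_gradient_le hc x (2^-1 *: y + (1 - 2^-1) *: x).
have -> : 2^-1 *: y + (1 - 2^-1) *: x - x = 2^-1 *: (y - x).
  by rewrite scalerBr scalerBl scale1r addrAC -addrA addKr.
rewrite dotpZr.
have h2 : 0 < (2^-1 : R) < 1 by apply/andP; split; lra.
have := hsc y x 2^-1 (fun e => xy (esym e)) h2.
lra.
Qed.

(** Sum of the strict gradient inequalities at [x] and at [y]. *)
Lemma strictly_convex_gradient_mono :
  (forall (x y : 'cV[R]_n) (t : R), x <> y -> 0 < t < 1 ->
    h (t *: x + (1 - t) *: y) < t * h x + (1 - t) * h y) ->
  convex_fun h ->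
  forall x y : 'cV[R]_n, x <> y -> 0 < dotp (x - y) (g x - g y).
Proof.
move=> hsc hc x y xy.
have h1 := strictly_convex_gradient_lt hsc hc xy.
have h2 := strictly_convex_gradient_lt hsc hc (fun e => xy (esym e)).
move: h1 h2; rewrite !(dotpBr, dotpBl) !(dotpC (g _)).
lra.
Qed.

End ConvexGradient.

(** * Compact annuli and extrema of continuous functions on them *)

Section Compactness.
Context {R : realType} {n : nat}.
Implicit Types (u v w : 'cV[R]_n).

Lemma continuous_dotp (T : topologicalType) (u v : T -> 'cV[R]_n) :
  continuous u -> continuous v -> continuous (fun t => dotp (u t) (v t)).
Proof.
move=> hu hv t.
under eq_fun do rewrite dotpE.
apply: cvg_big => [|k _]; first exact: add_continuous.
by apply: cvgM; apply: (continuous_comp (g := fun M : 'cV[R]_n => M k 0));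
  [exact: hu|exact: coord_continuous|exact: hv|exact: coord_continuous].
Qed.

Lemma continuous_subc (g : 'cV[R]_n -> 'cV[R]_n) (c : 'cV[R]_n) :
  continuous g -> continuous (fun v => g v - c).
Proof.
move=> gc v; apply: (@cvgB _ _ _ (nbhs v) _ g (cst c)); first exact: gc.
exact: cvg_cst.
Qed.

(** The box is the image, under transposition, of a product of segments of row coordinates;
    transposition is continuous because it preserves the sup norm. *)
Lemma compact_cV_box (a : R) :
  compact [set v : 'cV[R]_n | forall k, `|v k 0| <= a].
Proof.
pose K := [set v : 'rV[R]_n | forall k, `[- a, a]%classic (v ord0 k)].
have Kco : compact K.
  apply: (rV_compact (A := fun=> `[- a, a]%classic)) => _.
  exact: segment_compact.
have tr_cont : continuous (fun v : 'rV[R]_n => v^T : 'cV[R]_n).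
  move=> v; have distP V := @cvgrPdist_lt R V _ (nbhs v) (nbhs_filter v).
  apply/distP => e e0; near=> w.
  have : `|v - w| < e by near: w; apply: (iffLR (distP _ id v) _ e e0); exact: cvg_id.
  rewrite -linearB/= !/Num.Def.normr/= !mx_normrE => /bigmax_ltP[_ H].
  by apply/bigmax_ltP; split => // -[i j] _ /=; rewrite mxE; exact: (H (j, i)).
have := continuous_compact (continuous_subspaceT tr_cont) Kco.
congr compact; apply/seteqP; split => [_ [v Kv <-] k|v vK] /=.
  by rewrite mxE ler_norml; have := Kv k; rewrite /= in_itv.
exists v^T; last exact: trmxK.
by move=> k; rewrite /= mxE in_itv/= -ler_norml; exact: vK.
Unshelve. all: by end_near. Qed.

Lemma compact_dotp_annulus (c : 'cV[R]_n) (r M : R) :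
  compact [set v : 'cV[R]_n | r <= dotp (v - c) (v - c) <= M].
Proof.
pose q (v : 'cV[R]_n) := dotp (v - c) (v - c).
have qc : continuous q.
  by apply: continuous_dotp; apply: continuous_subc => v; exact: cvg_id.
have cl : closed (q @^-1` `[r, M]).
  by apply: closed_comp => [v _|]; [exact: qc|exact: itv_closed].
have -> : [set v : 'cV[R]_n | r <= dotp (v - c) (v - c) <= M] = q @^-1` `[r, M].
  by apply/seteqP; split => v /=; rewrite in_itv.
(* The radius comes from [|v_k| <= |c_k| + |v_k - c_k|]. The bound [M + 1] on the last term avoids a
   square root: [y ^+ 2 <= M] gives [y <= M + 1] since [(y - 1/2) ^+ 2 >= 0]. *)
apply: (subclosed_compact cl
  (compact_cV_box (a := \sum_k `|c k 0| + (M + 1)))).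
move=> v; rewrite /= in_itv/= => /andP[_ vM] k.
have := sqr_coord_le_dotp (v - c) k; rewrite !mxE => h.
have hc : `|c k 0| <= \sum_k `|c k 0|.
  by rewrite (bigD1 k)//= lerDl sumr_ge0.
have : `|v k 0 - c k 0| <= M + 1.
  have h2 : `|v k 0 - c k 0| ^+ 2 <= M.
    by rewrite real_normK ?num_real//; exact: le_trans h vM.
  move: h2; move: `|_| => y h2.
  by have := sqr_ge0 (y - 2^-1); rewrite sqrrB; lra.
by have := ler_normD (c k 0) (v k 0 - c k 0); rewrite addrC subrK; lra.
Qed.

(** As [r > 0] keeps [c] out of the annulus, the minimum attained there is positive. If the annulus
    is empty, any positive [d] will do. *)
Lemma annulus_min (w : 'cV[R]_n -> R) (c : 'cV[R]_n) (r M : R) :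
  continuous w -> 0 < r -> (forall v, v <> c -> 0 < w v) ->
  exists2 d, 0 < d & forall v, r <= dotp (v - c) (v - c) <= M -> d <= w v.
Proof.
move=> wc r0 wpos.
set K := [set v : 'cV[R]_n | r <= dotp (v - c) (v - c) <= M].
have [K0|/set0P/negP] := pselect (K !=set0); last first.
  move=> /negPn/eqP K0; exists 1 => // v vK.
  by have : K v by []; rewrite K0.
have [v0 /set_mem/= v0K v0min] :=
  compact_EVT_min K0 (@compact_dotp_annulus c r M) (continuous_subspaceT wc).
exists (w v0) => [|v vK]; last by apply: v0min; exact/mem_set.
apply: wpos => v0c; move: v0K; rewrite v0c /K/= subrr dotp0r => /andP[].
by rewrite leNgt r0.
Qed.

Lemma annulus_dotp_bounded (g : 'cV[R]_n -> 'cV[R]_n) (c : 'cV[R]_n) (M : R) :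
  continuous g ->
  exists B, forall v, dotp (v - c) (v - c) <= M -> dotp (g v) (g v) <= B.
Proof.
move=> gc.
set K := [set v : 'cV[R]_n | 0 <= dotp (v - c) (v - c) <= M].
have [K0|/set0P/negP] := pselect (K !=set0); last first.
  move=> /negPn/eqP K0; exists 0 => v vK.
  have : K v by rewrite /K/= dotp_ge0.
  by rewrite K0.
have [v0 _ v0max] := compact_EVT_max K0 (@compact_dotp_annulus c 0 M)
  (continuous_subspaceT (continuous_dotp gc gc)).
exists (dotp (g v0) (g v0)) => v vK; apply: v0max; apply/mem_set.
by rewrite /K/= dotp_ge0.
Qed.

(** Links the Euclidean square, used in the estimates, to the sup norm that defines the topology. *)
Lemma cvg_dotp_to0 (T : Type) (F : set_system T) (FF : Filter F)
    (u : T -> 'cV[R]_n) (c : 'cV[R]_n) :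
  (forall e, 0 < e -> \forall t \near F, dotp (u t - c) (u t - c) < e) ->
  u @ F --> c.
Proof.
move=> ule; apply/cvgrPdist_lt => e e0.
have e20 : 0 < e ^+ 2 by rewrite exprn_gt0.
apply: filterS (ule _ e20) => t ht.
rewrite /Num.Def.normr/= mx_normrE; apply/bigmax_ltP; split => // -[k j] _ /=.
rewrite !mxE (ord1 j) distrC -(@ltr_pXn2r _ 2)// ?nnegrE ?ltW//.
rewrite real_normK ?num_real//; apply: le_lt_trans ht.
by have := sqr_coord_le_dotp (u t - c) k; rewrite !mxE.
Qed.

End Compactness.

(** * A Barbalat argument for a Lyapunov function *)

Section Barbalat.
Context {R : realType}.

(** With [0 < a] the whole segment lies where the derivative is known, so continuity at both
    endpoints follows from it. *)
Lemma mvt_le (F dF : R -> R) (a b : R) : 0 < a -> a <= b ->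
  (forall t : R, 0 < t -> is_derive t 1 F (dF t)) ->
  exists2 t, a <= t <= b & F b - F a = dF t * (b - a).
Proof.
move=> a0 ab hF.
have [t /[!in_itv]/= /andP[at_ _]||t] := @MVT_segment _ F dF a b ab.
- by apply: hF; exact: lt_trans at_.
- apply: continuous_in_subspaceT => t /set_mem/= /[!in_itv]/= /andP[at_ _].
  apply/differentiable_continuous/derivable1_diffP.
  by have [] := hF t (lt_le_trans a0 at_).
- by rewrite in_itv /= => tab ->; exists t.
Qed.

(* Each excursion of [q] above [e] keeps [q] above [e/2] for a fixed duration,
   during which [V] drops by a fixed amount; as [V >= 0] there are finitely many. *)
Lemma barbalat_lyapunov (V dV q dq : R -> R) (K : R) :
  (forall t : R, 0 < t -> is_derive t 1 V (dV t)) ->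
  (forall t : R, 0 < t -> is_derive t 1 q (dq t)) ->
  (forall t : R, 0 <= V t) -> (forall t : R, 1 <= t -> dV t <= 0) ->
  (forall t : R, 1 <= t -> `|dq t| <= K) ->
  (forall r, 0 < r ->
    exists2 c, 0 < c & forall t : R, 1 <= t -> r <= q t -> dV t <= - c) ->
  forall e, 0 < e -> \forall t \near +oo, q t < e.
Proof.
move=> hV hq V0 dV0 dqK hc e e0; apply: contrapT => nq.
have exc T : exists2 t, T <= t & e <= q t.
  apply: contrapT => nT; apply: nq; exists T; split; first exact: num_real.
  move=> t Tt; rewrite ltNge; apply/negP => et; apply: nT; exists t => //.
  exact: ltW.
have K0 : 0 <= K by apply: le_trans (dqK 1 (lexx _)).
have e20 : 0 < e / 2 by rewrite divr_gt0.
have [c c0 hdV] := hc _ e20.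
(* Starting from [q t >= e] with speed at most [K], [q] stays above [e / 2] for a time [del];
   [K + 1] avoids dividing by zero. *)
pose del := e / 2 / (K + 1).
have K1 : 0 < K + 1 by lra.
have del0 : 0 < del by rewrite divr_gt0.
have Kdel : K * del <= e / 2.
  by rewrite /del mulrCA -[leRHS]mulr1 ler_pM2l// ler_pdivrMr//; lra.
have Vdec s t : 1 <= s -> s <= t -> V t <= V s.
  move=> s1 st; have s0 : 0 < s by lra.
  have [z /andP[sz _] hz] := mvt_le s0 st hV.
  have z1 := dV0 z (le_trans s1 sz).
  by rewrite -subr_le0 hz mulr_le0_ge0// subr_ge0.
have drop t : 1 <= t -> e <= q t -> V (t + del) <= V t - c * del.
  move=> t1 et; have t0 : 0 < t by lra.
  have ttd : t <= t + del by lra.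
  have [z /andP[tz zt] hz] := mvt_le t0 ttd hV.
  have qz : e / 2 <= q z.
    have [y /andP[ty _] hy] := mvt_le t0 tz hq.
    have y1 := dqK y (le_trans t1 ty).
    have h1 : `|dq y * (z - t)| <= K * del.
      rewrite normrM ler_pM// ger0_norm; lra.
    rewrite -hy in h1.
    have := ler_norm (q t - q z); rewrite distrC; lra.
  have := hdV z (le_trans t1 tz) qz.
  rewrite [t + del]addrC addrK in hz.
  rewrite -(ler_pM2r del0) mulNr -hz [del + t]addrC; lra.
have many N : exists2 t, 1 <= t & V t <= V 1 - N%:R * (c * del).
  elim: N => [|N [t t1 IH]]; first by exists 1 => //; rewrite mul0r subr0.
  have [s ts es] := exc t.
  exists (s + del); first lra.
  have := drop s (le_trans t1 ts) es; have := Vdec t s t1 ts.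
  rewrite -natr1 mulrDl mul1r; lra.
have cd0 : 0 < c * del by rewrite mulr_gt0.
(* More than [V 1 / (c * del)] drops would make [V] negative. *)
have [t t1 ht] := many (Num.bound (V 1 / (c * del))).
have := archi_boundP (divr_ge0 (V0 1) (ltW cd0)).
rewrite ltr_pdivrMr//; have := V0 t; lra.
Qed.

End Barbalat.

(** * The orthogonal projection onto the row space of a matrix *)

Section RowSpaceProjection.
Context {R : realType} {d n : nat}.
Variable A : 'M[R]_(d, n).

(** Consistency equates [A i j] and [A j i] only up to a cast of the number of rows, which the
    projection does not see. *)
Lemma Pmat_castmx (d' : nat) (e : d = d') :
  Pmat (castmx (e, erefl n) A) = Pmat A.
Proof. by case: _ / e; rewrite castmx_id. Qed.

Lemma trmx_Pmat : (Pmat A)^T = Pmat A.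
Proof. by rewrite /Pmat !trmx_mul trmx_inv !trmx_mul !trmxK mulmxA. Qed.

Hypothesis A_unit : A *m A^T \in unitmx.

Lemma mulmx_Pmat : A *m Pmat A = A.
Proof. by rewrite /Pmat !mulmxA mulmxV// mul1mx. Qed.

Lemma Pmat_idem : Pmat A *m Pmat A = Pmat A.
Proof. by rewrite {1}/Pmat -!mulmxA mulmx_Pmat mulmxA. Qed.

(** If [A *m x = b], then [bbar A b] is [Pmat A *m x], and the projection is idempotent. *)
Lemma Pmat_bbar (x : 'cV[R]_n) (b : 'cV[R]_d) :
  A *m x = b -> Pmat A *m bbar A b = Pmat A *m x.
Proof. by move=> <-; rewrite /bbar (mulmxA _ A) -/(Pmat A) mulmxA Pmat_idem. Qed.

Lemma dotp_Pmat (u : 'cV[R]_n) :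
  dotp u (Pmat A *m u) = dotp (Pmat A *m u) (Pmat A *m u).
Proof. exact: dotp_projection trmx_Pmat Pmat_idem. Qed.

End RowSpaceProjection.

(** * The range of a self-adjoint map *)

Section SelfAdjointRange.
Context {R : realType} {m n : nat}.

Local Notation ip X Y := (\sum_(ik : 'I_m * 'I_n) X ik.1 ik.2 * Y ik.1 ik.2).

(** [G] is in the range as soon as every cokernel column annihilates it. Such a column, reshaped as
    a matrix [X], is orthogonal to the range, so [|f X|^2 = <f (f X), X> = 0]; thus [X] is in the
    kernel and is orthogonal to [G]. *)
Lemma selfadjoint_range (f : {linear 'M[R]_(m, n) -> 'M[R]_(m, n)})
    (G : 'M[R]_(m, n)) :
  (forall X Y : 'M[R]_(m, n), ip (f X) Y = ip X (f Y)) ->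
  (forall X : 'M[R]_(m, n), f X = 0 -> ip G X = 0) -> exists Y, f Y = G.
Proof.
move=> f_sa Gker.
have vecE (X : 'M[R]_(m, n)) (c : 'cV[R]_(m * n)) :
    (mxvec X *m c) 0 0 = ip X (vec_mx c^T).
  rewrite mxE (reindex _ (curry_mxvec_bij _ _)) /=.
  by apply: eq_bigr => -[i k] _ /=; rewrite mxvecE !mxE.
have : (mxvec G <= lin_mx f)%MS.
  rewrite submxE; apply/eqP/rowP => k; rewrite [RHS]mxE.
  pose c := col k (cokermx (lin_mx f)).
  have fc : lin_mx f *m c = 0 by rewrite /c colE mulmxA mulmx_coker mul0mx.
  have fX0 : f (vec_mx c^T) = 0.
    set X := vec_mx c^T.
    have : ip (f X) (f X) = 0.
      by rewrite -f_sa -vecE -mul_vec_lin -mulmxA fc mulmx0 mxE.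
    move=> /eqP; rewrite psumr_eq0 => [/allP h|ik _]; last first.
      by rewrite -expr2 sqr_ge0.
    apply/matrixP => i j; rewrite [RHS]mxE; apply/eqP.
    by have := h (i, j); rewrite mem_index_enum -expr2 sqrf_eq0 => /(_ isT).
  rewrite [RHS](esym (Gker _ fX0)) -vecE !mxE.
  by apply: eq_bigr => j _; rewrite [c _ _]mxE.
move=> /submxP[y Gy]; exists (vec_mx y).
by apply: (can_inj mxvecK); rewrite Gy mul_rV_lin.
Qed.

End SelfAdjointRange.

(** * The graph Laplacian with matrix edge weights *)

Section Laplacian.
Context {R : realType} {m n : nat}.
Variables (adj : rel 'I_m) (P : 'I_m -> 'I_m -> 'M[R]_n).
Implicit Types u v : 'I_m -> 'cV[R]_n.

(** For symmetric adjacency and weights this is the operator [Hbar' Pbar Hbar], written node by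
    node. *)
Definition laplacian v i := \sum_(j < m | adj i j) P i j *m (v i - v j).

Hypothesis adj_sym : forall i j, adj i j = adj j i.
Hypothesis P_sym : forall i j, adj i j -> P i j = P j i.
Hypothesis P_tr : forall i j, (P i j)^T = P i j.

(** Swapping the endpoints of every edge replaces [u i] by [- u j]; adding both expressions yields
    the differences. The factor 2 reflects that each edge is counted in both directions. *)
Lemma laplacian_form u v : 2 * (\sum_i dotp (u i) (laplacian v i)) =
  \sum_i \sum_(j | adj i j) dotp (u i - u j) (P i j *m (v i - v j)).
Proof.
pose S := \sum_i \sum_(j | adj i j) dotp (u i) (P i j *m (v i - v j)).
have -> : \sum_i dotp (u i) (laplacian v i) = S.
  by apply: eq_bigr => i _; rewrite dotp_sumr.
have S' : S = - \sum_i \sum_(j | adj i j) dotp (u j) (P i j *m (v i - v j)).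
  rewrite /S (exchange_big_dep xpredT)//= -sumrN; apply: eq_bigr => j _.
  rewrite -sumrN; apply: eq_big => [i|i ij]; first exact: adj_sym.
  by rewrite -dotpNr -mulmxN opprB P_sym.
rewrite mulr2n mulrDl mul1r {2}S' /S -sumrB; apply: eq_bigr => i _.
by rewrite -sumrB; apply: eq_bigr => j _; rewrite dotpBl.
Qed.

Lemma laplacian_selfadjoint u v :
  \sum_i dotp (u i) (laplacian v i) = \sum_i dotp (laplacian u i) (v i).
Proof.
apply: (@mulfI _ 2) => //.
under [in RHS]eq_bigr do rewrite dotpC.
rewrite !laplacian_form; apply: eq_bigr => i _; apply: eq_bigr => j _.
by rewrite -dotp_trmx_mull P_tr dotpC.
Qed.

Lemma laplacianB u v i :
  laplacian (fun i => u i - v i) i = laplacian u i - laplacian v i.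
Proof.
rewrite -sumrB; apply: eq_bigr => j _.
by rewrite -mulmxBr; congr (_ *m _); rewrite !opprD !opprK addrACA.
Qed.

Lemma laplacian_linear (a : R) u v i :
  laplacian (fun i => a *: u i + v i) i = a *: laplacian u i + laplacian v i.
Proof.
rewrite scaler_sumr -big_split/=; apply: eq_bigr => j _.
by rewrite scalemxAr -mulmxDr scalerBr opprD addrACA.
Qed.

Hypothesis P_idem : forall i j, adj i j -> P i j *m P i j = P i j.

Let dotpP i j (w : 'cV[R]_n) : adj i j ->
  dotp w (P i j *m w) = dotp (P i j *m w) (P i j *m w).
Proof. by move=> ij; apply: dotp_projection => //; exact: P_idem. Qed.

Lemma laplacian_ge0 v : 0 <= \sum_i dotp (v i) (laplacian v i).
Proof.
rewrite -(@pmulr_rge0 _ 2)// laplacian_form.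
by apply: sumr_ge0 => i _; apply: sumr_ge0 => j ij; rewrite dotpP// dotp_ge0.
Qed.

(** The quadratic form of the Laplacian is a sum of squares [|P_ij (v_i - v_j)|^2], so its vanishing
    forces each of them to vanish. *)
Lemma laplacian_eq0 v : (forall i, laplacian v i = 0) ->
  forall i j, adj i j -> P i j *m (v i - v j) = 0.
Proof.
move=> Lv0 i j ij.
have /eqP : 2 * (\sum_i dotp (v i) (laplacian v i)) = 0.
  by rewrite big1 ?mulr0// => k _; rewrite Lv0 dotp0r.
have pos k l : adj k l -> 0 <= dotp (v k - v l) (P k l *m (v k - v l)).
  by move=> kl; rewrite dotpP// dotp_ge0.
rewrite laplacian_form psumr_eq0 => [/allP/(_ i)|k _]; last first.
  by apply: sumr_ge0 => l; exact: pos.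
rewrite mem_index_enum => /(_ isT).
rewrite psumr_eq0 => [/allP/(_ j)|l]; last exact: pos.
by rewrite mem_index_enum ij dotpP// => /(_ isT)/eqP/dotp_eq0.
Qed.

Lemma laplacian_range (g : 'I_m -> 'cV[R]_n) :
  (forall v, (forall i, laplacian v i = 0) -> \sum_i dotp (g i) (v i) = 0) ->
  exists v, forall i, laplacian v i = g i.
Proof.
move=> gker.
(* Families of columns are identified with matrices, one row per node, to make the Laplacian a
   linear endomorphism of a matrix space. *)
pose stack (v : 'I_m -> 'cV[R]_n) : 'M[R]_(m, n) := \matrix_(i, k) v i k 0.
pose unstack (X : 'M[R]_(m, n)) i : 'cV[R]_n := (row i X)^T.
have stackK v : unstack (stack v) = v.
  by apply/funext => i; apply/colP => k; rewrite !mxE.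
have unstackK X : stack (unstack X) = X.
  by apply/matrixP => i k; rewrite !mxE.
have ipE (X Y : 'M[R]_(m, n)) :
    \sum_(ik : 'I_m * 'I_n) X ik.1 ik.2 * Y ik.1 ik.2 =
    \sum_i dotp (unstack X i) (unstack Y i).
  rewrite -(pair_bigA _ (fun i k => X i k * Y i k))/=.
  by apply: eq_bigr => i _; rewrite dotpE; apply: eq_bigr => k _; rewrite !mxE.
pose F X := stack (laplacian (unstack X)).
have F_lin : linear F.
  move=> a X Y; apply/matrixP => i k; rewrite !mxE.
  have -> : unstack (a *: X + Y) = fun i => a *: unstack X i + unstack Y i.
    by apply/funext => j; apply/colP => l; rewrite !mxE.
  by rewrite laplacian_linear !mxE.
pose f : {linear 'M[R]_(m, n) -> 'M[R]_(m, n)} :=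
  HB.pack F (GRing.isLinear.Build _ _ _ _ F F_lin).
have [|X FX0|Y fY] := @selfadjoint_range _ _ _ f (stack g).
- by move=> X Y; rewrite !ipE /f/= /F !stackK laplacian_selfadjoint.
- rewrite ipE stackK; apply: gker => i.
  by rewrite -[laplacian _](stackK) -/(F X) [F X]FX0; apply/colP => k; rewrite !mxE.
exists (unstack Y) => i.
by rewrite -[laplacian _]stackK -/(F Y) [F Y]fY stackK.
Qed.

End Laplacian.

(** * Componentwise strict convexity and first-order optimality *)

Section Optimality.
Context {R : realType} {m n : nat} (f : 'I_m -> 'cV[R]_n -> R).

(** Only block [i] is varied and the others are frozen at 0, so their contributions [f j 0] cancel
    from both sides. *)
Lemma sumf_strictly_convex_component :
  strictly_convex_stack (sumf f) ->
  forall i (x y : 'cV[R]_n) (t : R), x <> y -> 0 < t < 1 ->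
    f i (t *: x + (1 - t) *: y) < t * f i x + (1 - t) * f i y.
Proof.
move=> fsc i x y t xy t01.
pose X (z : 'cV[R]_n) j := if j == i then z else 0.
have XY : X x <> X y by move=> /(congr1 (@^~ i)); rewrite /X eqxx.
have := fsc _ _ _ XY t01.
rewrite /sumf !(bigD1 (P := xpredT) i)//= {1 3 5}/X eqxx.
have e z : \sum_(j < m | j != i) f j (X z j) = \sum_(j < m | j != i) f j 0.
  by apply: eq_bigr => j /negbTE ji; rewrite /X ji.
rewrite !e (eq_bigr (fun j => f j 0)); last first.
  by move=> j /negbTE ji; rewrite /X ji !scaler0 addr0.
rewrite /X eqxx; lra.
Qed.

Variables (gradf : 'I_m -> 'cV[R]_n -> 'cV[R]_n).
Variables (adj : rel 'I_m) (d : 'I_m -> 'I_m -> nat).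
Variables (A : forall i j, 'M[R]_(d i j, n)) (b : forall i j, 'cV[R]_(d i j)).

(** Moving from [xs] along [v] or [- v] preserves feasibility, so the derivative of the cost along
    [v] has both signs. *)
Lemma solution_gradient_orthogonal (xs v : 'I_m -> 'cV[R]_n) :
  (forall i, is_gradient (f i) (gradf i)) ->
  is_solution f adj A b xs ->
  (forall i j, adj i j -> A i j *m (v i - v j) = 0) ->
  \sum_i dotp (gradf i (xs i)) (v i) = 0.
Proof.
move=> fg [xsF xsmin].
wlog suff : v / (forall i j, adj i j -> A i j *m (v i - v j) = 0) ->
    - \sum_i dotp (gradf i (xs i)) (v i) <= 0.
  move=> H Av; apply/eqP; rewrite eq_le -oppr_le0 (H v Av) andbT.
  rewrite -[X in X <= _]opprK -sumrN.
  rewrite (eq_bigr (fun i => dotp (gradf i (xs i)) (- v i))).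
    by apply: H => i j ij; rewrite -opprD mulmxN Av ?oppr0.
  by move=> i _; rewrite dotpNr.
move=> Av.
have dsum := is_derive_sum (fun i => is_derive_line (fg i (xs i) (v i))).
(* Negating the cost turns minimality into an upper bound on difference quotients, here with
   [c = 0]. *)
apply: (is_derive_le (is_deriveN dsum)) => s s01.
rewrite mulr0 subr_le0 !fctE !fct_sumE lerN2.
rewrite [leLHS](eq_bigr (fun i => f i (xs i))); last first.
  by move=> i _; rewrite scale0r addr0.
apply: xsmin => i j ij.
by rewrite opprD addrACA -scalerBr mulmxDr -scalemxAr Av// scaler0 addr0 xsF.
Qed.

End Optimality.

(** * Curves bounded from time 1 on *)

Section DotBounded.
Context {R : realType} {n : nat}.
Implicit Types u v : R -> 'cV[R]_n.

Definition dotp_bounded u :=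
  exists B, forall t, 1 <= t -> dotp (u t) (u t) <= B.

(** From [|u - v|^2 >= 0] follows [|u + v|^2 <= 2 (|u|^2 + |v|^2)]. *)
Lemma dotp_boundedD u v :
  dotp_bounded u -> dotp_bounded v -> dotp_bounded (fun t => u t + v t).
Proof.
move=> [B hB] [C hC]; exists (2 * (B + C)) => t t1.
have := dotp_ge0 (u t - v t); rewrite !(dotpDl, dotpDr, dotpNl, dotpNr).
by have := hB t t1; have := hC t t1; lra.
Qed.

Lemma dotp_boundedN u : dotp_bounded u -> dotp_bounded (fun t => - u t).
Proof. by move=> [B hB]; exists B => t t1; rewrite dotpNl dotpNr opprK hB. Qed.

Lemma dotp_boundedB u v :
  dotp_bounded u -> dotp_bounded v -> dotp_bounded (fun t => u t - v t).
Proof. by move=> hu hv; apply: dotp_boundedD => //; exact: dotp_boundedN. Qed.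

Lemma dotp_bounded_cst (w : 'cV[R]_n) : dotp_bounded (fun=> w).
Proof. by exists (dotp w w). Qed.

Lemma dotp_bounded_sum (I : finType) (p : pred I) (F : I -> R -> 'cV[R]_n) :
  (forall i, p i -> dotp_bounded (F i)) ->
  dotp_bounded (fun t => \sum_(i | p i) F i t).
Proof.
move=> hF; rewrite (_ : (fun t => _) = \sum_(i | p i) F i); last first.
  by apply/funext => t; rewrite fct_sumE.
apply: big_ind => //; last exact: dotp_boundedD.
exact: dotp_bounded_cst.
Qed.

(** An orthogonal projection is a contraction: [|u|^2 - |P u|^2 = |u - P u|^2 >= 0]. *)
Lemma dotp_bounded_Pmat d (A : 'M[R]_(d, n)) u : A *m A^T \in unitmx ->
  dotp_bounded u -> dotp_bounded (fun t => Pmat A *m u t).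
Proof.
move=> A_unit [B hB]; exists B => t t1; apply: le_trans (hB t t1).
have := dotp_ge0 (u t - Pmat A *m u t).
rewrite !(dotpBl, dotpBr) (dotpC _ (u t)) dotp_Pmat//; lra.
Qed.

End DotBounded.

(** * Lyapunov analysis of the saddle-point flow *)

Unset Implicit Arguments. Set Strict Implicit. Set Printing Implicit Defensive.

Theorem theorem1 (R : realType) (m n : nat)
  (adj : rel 'I_m)
  (d : 'I_m -> 'I_m -> nat)
  (A : forall i j : 'I_m, 'M[R]_(d i j, n))
  (b : forall i j : 'I_m, 'cV[R]_(d i j))
  (f : 'I_m -> 'cV[R]_n -> R)
  (gradf : 'I_m -> 'cV[R]_n -> 'cV[R]_n)
  (* undirected simple graph *)
  (adj_sym : forall i j, adj i j = adj j i)
  (adj_irr : forall i, ~~ adj i i)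
  (* A_ij A_ij' invertible *)
  (A_inv : forall i j, adj i j -> A i j *m (A i j)^T \in unitmx)
  (* f_i continuously differentiable and convex *)
  (f_grad : forall i, is_gradient (f i) (gradf i))
  (gradf_cont : forall i, continuous (gradf i))
  (f_convex : forall i, convex_fun (f i))
  (* f = \sum_i f_i strictly convex on R^{mn} *)
  (f_sconvex : strictly_convex_stack (sumf f))
  (* Existence *)
  (H_exists : exists Xs, is_solution f adj A b Xs)
  (* Consistency: A_ij = A_ji, b_ij = - b_ji *)
  (H_consistent : forall i j, adj i j ->
      exists e : d i j = d j i,
        castmx (e, erefl n) (A i j) = A j i /\
        castmx (e, erefl 1%N) (b i j) = - b j i)
  (* Well-configured: connected graph and ker Hbar' /\ image Pbar = {0} *)
  (H_connected : forall i j : 'I_m, connect adj i j)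
  (H_kernel : well_configured_kernel adj (fun i j => Pmat (A i j)))
  (* any trajectory of the distributed update, from any x(0), lambda(0) *)
  (x lam : R -> 'I_m -> 'cV[R]_n)
  (x_cont0 : forall i, (fun t => x t i) @ at_right 0 --> x 0 i)
  (lam_cont0 : forall i, (fun t => lam t i) @ at_right 0 --> lam 0 i)
  (x_ode : forall t : R, 0 < t -> forall i,
      is_derive t (1 : R) (fun s => x s i)
        (- gradf i (x t i)
         - \sum_(j < m | adj i j) Pmat (A i j) *m (lam t i - lam t j)
         - \sum_(j < m | adj i j)
             Pmat (A i j) *m (x t i - x t j - bbar (A i j) (b i j))))
  (lam_ode : forall t : R, 0 < t -> forall i,
      is_derive t (1 : R) (fun s => lam s i)
        (\sum_(j < m | adj i j)
             Pmat (A i j) *m (x t i - x t j - bbar (A i j) (b i j)))) :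
  exists xs : 'I_m -> 'cV[R]_n,
    (forall i, (fun t => x t i) @ +oo --> xs i) /\
    is_solution f adj A b xs.
Proof.
have [xs xs_sol] := H_exists; exists xs; split => // i0.
have xsF := xs_sol.1.
pose P i j := Pmat (A i j); pose L := laplacian adj P.
have P_sym i j : adj i j -> P i j = P j i.
  by rewrite /P => /H_consistent[e [<- _]]; rewrite Pmat_castmx.
have P_tr i j : (P i j)^T = P i j by exact: trmx_Pmat.
have P_idem i j : adj i j -> P i j *m P i j = P i j.
  by move=> ij; apply: Pmat_idem; exact: A_inv.
(* KKT: the gradient at the optimum is orthogonal to the kernel of the
   self-adjoint [L], hence lies in its range. *)
have [ls lsE] : exists ls, forall i, L ls i = - gradf i (xs i).
  apply: laplacian_range => // v Lv0.
  under eq_bigr do rewrite dotpNl.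
  rewrite sumrN (solution_gradient_orthogonal f_grad xs_sol) ?oppr0// => i j ij.
  (* Since [A = A P], a kernel vector of [L], for which [P_ij (v_i - v_j) = 0], is a feasible
     direction. *)
  rewrite -(mulmx_Pmat (A_inv i j ij)) -mulmxA.
  by rewrite [Pmat _ *m _](laplacian_eq0 adj_sym P_sym P_tr P_idem Lv0 ij) mulmx0.
pose y (t : R) i : 'cV[R]_n := x t i - xs i.
pose mu (t : R) i : 'cV[R]_n := lam t i - ls i.
pose W i (v : 'cV[R]_n) := dotp (v - xs i) (gradf i v - gradf i (xs i)).
pose dy (t : R) i : 'cV[R]_n :=
  - (gradf i (x t i) - gradf i (xs i)) - L (mu t) i - L (y t) i.
(* Under [P_ij], feasibility replaces the offset [bbar] by [xs i - xs j]. *)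
have Ly t i : \sum_(j < m | adj i j)
    Pmat (A i j) *m (x t i - x t j - bbar (A i j) (b i j)) = L (y t) i.
  rewrite /L laplacianB -sumrB; apply: eq_bigr => j ij.
  by rewrite mulmxBr (Pmat_bbar (A_inv i j ij) (xsF i j ij)).
have y_ode (t : R) : 0 < t -> forall i, is_derive t (1 : R) (y^~ i) (dy t i).
  move=> t0 i.
  apply: is_derive_eq (is_deriveB (x_ode t t0 i) (is_derive_cst (xs i) t 1)) _.
  rewrite subr0 Ly /dy; congr (_ - _).
  have -> : L (mu t) i = L (lam t) i + gradf i (xs i).
    by rewrite /L laplacianB -/L lsE opprK.
  rewrite opprB (addrC (L _ _)) opprD addrA (addrAC (gradf i (xs i))).
  by rewrite subrr sub0r.
have mu_ode (t : R) : 0 < t -> forall i, is_derive t (1 : R) (mu^~ i) (L (y t) i).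
  move=> t0 i.
  apply: is_derive_eq (is_deriveB (lam_ode t t0 i) (is_derive_cst (ls i) t 1)) _.
  by rewrite subr0 Ly.
pose V (t : R) : R := \sum_i (dotp (y t i) (y t i) + dotp (mu t i) (mu t i)).
pose dV (t : R) : R :=
  \sum_i (2 * dotp (y t i) (dy t i) + 2 * dotp (mu t i) (L (y t) i)).
have V_ode (t : R) : 0 < t -> is_derive t (1 : R) V (dV t).
  move=> t0.
  have -> : V = \sum_i ((fun t => dotp (y t i) (y t i)) +
                         (fun t => dotp (mu t i) (mu t i))).
    by apply/funext => s; rewrite fct_sumE.
  apply: is_derive_sum => i; apply: is_deriveD.
    apply: is_derive_eq (is_derive_dotp (y_ode t t0 i) (y_ode t t0 i)) _.
    by rewrite dotpC; lra.
  apply: is_derive_eq (is_derive_dotp (mu_ode t t0 i) (mu_ode t t0 i)) _.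
  by rewrite dotpC; lra.
have dVE t : dV t =
    - 2 * (\sum_i W i (x t i)) - 2 * \sum_i dotp (y t i) (L (y t) i).
  have sa : \sum_i dotp (mu t i) (L (y t) i) = \sum_i dotp (y t i) (L (mu t) i).
    rewrite laplacian_selfadjoint//.
    by apply: eq_bigr => i _; rewrite dotpC.
  have dyE i : dotp (y t i) (dy t i) =
      - W i (x t i) - dotp (y t i) (L (mu t) i) - dotp (y t i) (L (y t) i).
    by rewrite /dy dotpBr dotpBr dotpNr.
  rewrite /dV big_split/= -!mulr_sumr sa (eq_bigr _ (fun i _ => dyE i)).
  rewrite !sumrB sumrN; lra.
have W_pos i v : v <> xs i -> 0 < W i v.
  apply: (strictly_convex_gradient_mono (f_grad i)) => //.
  exact: sumf_strictly_convex_component.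
have W_ge0 i v : 0 <= W i v.
  have [->|/eqP/W_pos/ltW//] := eqVneq v (xs i).
  by rewrite /W !subrr dotp0r.
(* Only the share of agent [i] is kept; the other agents and the Laplacian form contribute
   nonpositive terms to [dV t]. *)
have dV_le t i : dV t <= - W i (x t i).
  rewrite dVE (bigD1 i)//=.
  have := laplacian_ge0 adj_sym P_sym P_tr P_idem (y t); rewrite -/L.
  have : 0 <= \sum_(j < m | j != i) W j (x t j) by apply: sumr_ge0.
  have := W_ge0 i (x t i); lra.
have dV_le0 t : dV t <= 0.
  by apply: le_trans (dV_le t i0) _; rewrite oppr_le0.
have V_ge i t : dotp (y t i) (y t i) + dotp (mu t i) (mu t i) <= V t.
  rewrite /V (bigD1 i)//= lerDl sumr_ge0// => j _.
  by rewrite addr_ge0// dotp_ge0.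
(* Time 1 serves as reference point inside the open half-line where the equations hold. *)
have V_le1 t : 1 <= t -> V t <= V 1.
  move=> t1; have [z _] := mvt_le ltr01 t1 V_ode.
  by rewrite -subr_le0 => ->; rewrite mulr_le0_ge0// subr_ge0.
have y_le i t : 1 <= t -> dotp (y t i) (y t i) <= V 1.
  move=> /V_le1; apply: le_trans; apply: le_trans (V_ge i t).
  by rewrite lerDl dotp_ge0.
have mu_le i t : 1 <= t -> dotp (mu t i) (mu t i) <= V 1.
  move=> /V_le1; apply: le_trans; apply: le_trans (V_ge i t).
  by rewrite lerDr dotp_ge0.
have L_bnd (v : R -> 'I_m -> 'cV[R]_n) i :
    (forall j, dotp_bounded (v^~ j)) -> dotp_bounded (fun t => L (v t) i).
  move=> vb; apply: dotp_bounded_sum => j ij.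
  by apply: dotp_bounded_Pmat; [exact: A_inv|exact: dotp_boundedB].
(* The gradient is bounded on the ball [|v - xs i0|^2 <= V 1] by compactness, and the Laplacian
   terms because [y] and [mu] are bounded. *)
have [K dyK] : dotp_bounded (dy^~ i0).
  have [B hB] := annulus_dotp_bounded (xs i0) (V 1) (gradf_cont i0).
  apply: dotp_boundedB; last by apply: L_bnd => j; exists (V 1) => t; exact: y_le.
  apply: dotp_boundedB; last by apply: L_bnd => j; exists (V 1) => t; exact: mu_le.
  apply/dotp_boundedN/dotp_boundedB; last exact: dotp_bounded_cst.
  by exists B => t t1; apply: hB; exact: y_le.
apply: cvg_dotp_to0.
(* The rate bound [V 1 + K] comes from [2 |y . dy| <= |y|^2 + |dy|^2]. *)
apply: (@barbalat_lyapunov _ V dV (fun t => dotp (y t i0) (y t i0))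
  (fun t => dotp (dy t i0) (y t i0) + dotp (y t i0) (dy t i0)) (V 1 + K)) => //.
- by move=> t t0; apply: is_derive_dotp; exact: y_ode.
- by move=> t; apply: sumr_ge0 => i _; rewrite addr_ge0// dotp_ge0.
- move=> t t1; have := dyK t t1; have := y_le i0 t t1.
  move: (y t i0) (dy t i0) => p q.
  have := dotp_ge0 (p - q); have := dotp_ge0 (p + q).
  rewrite !(dotpDl, dotpDr, dotpNl, dotpNr) (dotpC q) ler_norml; lra.
(* While [|y|^2 >= r], the state stays in the annulus between [r] and [V 1], where [W i0] has a
   positive lower bound. *)
- move=> r r0.
  have Wc : continuous (W i0).
    by apply: continuous_dotp; apply: continuous_subc => // v; exact: cvg_id.
  have [c c0 hc] := annulus_min (V 1) Wc r0 (W_pos i0).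
  exists c => // t t1 rq; apply: le_trans (dV_le t i0) _.
  by rewrite lerN2 hc// rq y_le.
Qed.
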